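(* Let $g$ be a problem. Then (1) $g$ is complete if and only if for all problems $f$: $f\le_W g\iff f\le_{tW} g$; (2) $g$ is strongly complete if and only if for all problems $f$: $f\le_{sW} g\iff f\le_{stW} g$.
   Context: A represented space $(X,\delta_X)$ is a set with a surjective partial map $\delta_X:\subseteq\mathbb{N}^\mathbb{N}\to X$. A problem $f:\subseteq X\rightrightarrows Y$ is a partial multi-valued map between represented spaces; $F:\subseteq\mathbb{N}^\mathbb{N}\to\mathbb{N}^\mathbb{N}$ is a realizer of $f$ if $\delta_YF(p)\in f(\delta_X(p))$ for all $p\in\mathrm{dom}(f\circ\delta_X)$, a total realizer if additionally $F$ is total. Pairing: $\langle p,q\rangle(2n)=p(n)$, $\langle p,q\rangle(2n+1)=q(n)$. $f\le_W g$ iff there are computable $H,K:\subseteq\mathbb{N}^\mathbb{N}\to\mathbb{N}^\mathbb{N}$ such that for every realizer $G$ of $g$, $p\mapsto H\langle p,GK(p)\rangle$ realizes $f$; $f\le_{sW}g$ iff there are computable $H,K$ with $HGK$ realizing $f$ for every realizer $G$ of $g$. A representation $\delta$ is precomplete if for every computable $F:\subseteq\mathbb{N}^\mathbb{N}\to\mathbb{N}^\mathbb{N}$ there is a total computable $G$ with $\delta F(p)=\delta G(p)$ for all $p\in\mathrm{dom}(F)$. $f\le_{tW}g$ (resp. $f\le_{stW}g$) is defined like $\le_W$ (resp. $\le_{sW}$) but after replacing all four representations by computably equivalent precomplete ones and requiring that for every total realizer $G$ of $g$, $H\langle\mathrm{id},GK\rangle$ (resp. $HGK$) is a total realizer of $f$.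 Completion: $p-1$ is the concatenation of $p(0)-1,p(1)-1,\dots$ with $0-1$ the empty word; $\delta_X^\wp(p):=\delta_X(p-1)$ if $p-1\in\mathrm{dom}(\delta_X)$; $\overline X=X\cup\{\bot\}$ with $\delta_{\overline X}(p)=\delta_X^\wp(p)$ if defined and $\bot$ otherwise; $\overline f:\overline X\rightrightarrows\overline Y$ with $\overline f(x)=f(x)$ for $x\in\mathrm{dom}(f)$ and $\overline Y$ otherwise. A problem $g$ is complete if $g\equiv_W\overline g$ and strongly complete if $g\equiv_{sW}\overline g$. *)

(* Defs.v *)
From mathcomp Require Import all_boot.
From mathcomp Require Import boolp.

Set Implicit Arguments.
Unset Strict Implicit.
Unset Printing Implicit Defensive.

(* Partial functions are given by their (single-valued) graphs: F a b means
   that F is defined at a with value b. *)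
Record pfun (A B : Type) := PFun {
  pgraph :> A -> B -> Prop;
  pgraph_fun : forall a b b', pgraph a b -> pgraph a b' -> b = b' }.

Definition pdom A B (F : pfun A B) (a : A) : Prop := exists b, F a b.

Definition ptotal A B (F : pfun A B) : Prop := forall a, pdom F a.

Lemma pcomp_fun A B C (G : pfun B C) (F : pfun A B) a c c' :
  (exists b, F a b /\ G b c) -> (exists b, F a b /\ G b c') -> c = c'.
Proof.
move=> [b [Fb Gb]] [b' [Fb' Gb']].
by move: Gb'; rewrite -(pgraph_fun Fb Fb'); apply: pgraph_fun.
Qed.

Definition pcomp A B C (G : pfun B C) (F : pfun A B) : pfun A C :=
  PFun (@pcomp_fun A B C G F).

Definition baire := nat -> nat.

Definition bpair (p q : baire) : baire :=
  fun n => if odd n then q n./2 else p n./2.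

Lemma pairid_fun (F : pfun baire baire) p r r' :
  (exists q, F p q /\ r = bpair p q) -> (exists q, F p q /\ r' = bpair p q) ->
  r = r'.
Proof. by move=> [q [Fq ->]] [q' [Fq' ->]]; rewrite (pgraph_fun Fq Fq'). Qed.

(* p |-> <p, F(p)> *)
Definition pairid (F : pfun baire baire) : pfun baire baire :=
  PFun (@pairid_fun F).

(* Codes for the mu-recursive functions relative to an oracle in Baire space.
   Arities are not tracked: a code is run on a list of arguments, and missing
   arguments are read as 0. *)
Inductive rcode : Type :=
| RZero
| RSucc
| ROracle
| RProj of nat
| RComp (m : nat) of rcode & ('I_m -> rcode)
| RPrim of rcode & rcode
| RMu of rcode.

(* reval p c v y: the computation of c with oracle p on the arguments v halts
   with result y. In RPrim the recursion variable is the first argument and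
   s lists the intermediate values; RMu finds the least y such that f(y, v) = 0
   with f(i, v) defined and nonzero for all i < y. *)
Fixpoint reval (p : baire) (c : rcode) (v : seq nat) (y : nat) : Prop :=
  match c with
  | RZero => y = 0
  | RSucc => y = (nth 0 v 0).+1
  | ROracle => y = p (nth 0 v 0)
  | RProj i => y = nth 0 v i
  | RComp m f gs =>
      exists w : m.-tuple nat,
        (forall i, reval p (gs i) v (tnth w i)) /\ reval p f w y
  | RPrim f g =>
      exists s : nat -> nat,
        [/\ reval p f (behead v) (s 0),
            forall i, i < head 0 v ->
              reval p g (i :: s i :: behead v) (s i.+1)
          & y = s (head 0 v)]
  | RMu f =>
      reval p f (y :: v) 0 /\
      forall i, i < y -> exists z, reval p f (i :: v) z.+1
  end.

(* No condition is imposed outside the domain of F. *)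
Definition computable (F : pfun baire baire) : Prop :=
  exists c : rcode, forall p q, F p q -> forall n, reval p c [:: n] (q n).

Record representation (X : Type) := Representation {
  rep :> pfun baire X;
  rep_surj : forall x, exists p, rep p x }.

Record repSpace := RepSpace {
  carrier :> Type;
  delta : representation carrier }.

(* A partial multi-valued map is given by its graph; it is defined at x when
   it has at least one value there. *)
Definition mdom (X Y : Type) (f : X -> Y -> Prop) (x : X) : Prop :=
  exists y, f x y.

Record problem := Problem {
  pin : repSpace;
  pout : repSpace;
  pmap :> pin -> pout -> Prop }.

Definition realizer X Y (dX : representation X) (dY : representation Y)
    (f : X -> Y -> Prop) (F : pfun baire baire) : Prop :=
  forall p x, dX p x -> mdom f x -> exists q y, [/\ F p q, dY q y & f x y].

Definition total_realizer X Y (dX : representation X) (dY : representation Y)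
    (f : X -> Y -> Prop) (F : pfun baire baire) : Prop :=
  ptotal F /\ realizer dX dY f F.

Definition realizes (f : problem) (F : pfun baire baire) : Prop :=
  realizer (delta (pin f)) (delta (pout f)) f F.

Definition leW (f g : problem) : Prop :=
  exists H K : pfun baire baire,
    [/\ computable H, computable K
      & forall G, realizes g G -> realizes f (pcomp H (pairid (pcomp G K)))].

Definition lesW (f g : problem) : Prop :=
  exists H K : pfun baire baire,
    [/\ computable H, computable K
      & forall G, realizes g G -> realizes f (pcomp H (pcomp G K))].

Definition equivW (f g : problem) : Prop := leW f g /\ leW g f.
Definition equivsW (f g : problem) : Prop := lesW f g /\ lesW g f.

Definition rep_le X (d d' : representation X) : Prop :=
  exists2 F : pfun baire baire, computable F &
    forall p x, d p x -> exists q, F p q /\ d' q x.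

Definition rep_equiv X (d d' : representation X) : Prop :=
  rep_le d d' /\ rep_le d' d.

(* The equality d(F(p)) = d(G(p)) is understood as: both sides are undefined,
   or both are defined and equal. *)
Definition precomplete X (d : representation X) : Prop :=
  forall F : pfun baire baire, computable F ->
    exists G : pfun baire baire,
      [/\ ptotal G, computable G
        & forall p, pdom F p -> forall x, pcomp d F p x <-> pcomp d G p x].

Definition precompletion X (d d' : representation X) : Prop :=
  rep_equiv d d' /\ precomplete d'.

Definition letW (f g : problem) : Prop :=
  exists (dX : representation (pin f)) (dY : representation (pout f))
         (dZ : representation (pin g)) (dW : representation (pout g)),
    [/\ precompletion (delta (pin f)) dX, precompletion (delta (pout f)) dY,
        precompletion (delta (pin g)) dZ, precompletion (delta (pout g)) dW
      & exists H K : pfun baire baire,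
          [/\ computable H, computable K
            & forall G, total_realizer dZ dW g G ->
                total_realizer dX dY f (pcomp H (pairid (pcomp G K)))]].

Definition lestW (f g : problem) : Prop :=
  exists (dX : representation (pin f)) (dY : representation (pout f))
         (dZ : representation (pin g)) (dW : representation (pout g)),
    [/\ precompletion (delta (pin f)) dX, precompletion (delta (pout f)) dY,
        precompletion (delta (pin g)) dZ, precompletion (delta (pout g)) dW
      & exists H K : pfun baire baire,
          [/\ computable H, computable K
            & forall G, total_realizer dZ dW g G ->
                total_realizer dX dY f (pcomp H (pcomp G K))]].

Definition dec_word (n : nat) : seq nat := if n is k.+1 then [:: k] else [::].

Definition dec_concat (p : baire) (n : nat) : seq nat :=
  flatten [seq dec_word (p i) | i <- iota 0 n].

(* p - 1 = q for an infinite q; when the concatenation p - 1 is a finite word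
   no q satisfies this. *)
Definition minus1_graph (p q : baire) : Prop :=
  forall k, exists n, prefix (mkseq q k) (dec_concat p n).

Lemma dec_concat_prefix p m n :
  m <= n -> prefix (dec_concat p m) (dec_concat p n).
Proof.
move=> le_mn; rewrite /dec_concat -(subnKC le_mn) iotaD map_cat flatten_cat.
exact: prefix_prefix.
Qed.

Lemma minus1_fun p q q' : minus1_graph p q -> minus1_graph p q' -> q = q'.
Proof.
move=> hq hq'; apply: funext => i.
have [n hn] := hq i.+1; have [n' hn'] := hq' i.+1.
pose s := dec_concat p (maxn n n').
have h1 := prefix_trans hn (dec_concat_prefix p (leq_maxl n n')).
have h2 := prefix_trans hn' (dec_concat_prefix p (leq_maxr n n')).
have E : mkseq q i.+1 = mkseq q' i.+1.
  move: h1 h2; rewrite !prefixE !size_mkseq => /eqP<- /eqP<- //.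
by have := congr1 (fun s => nth 0 s i) E; rewrite !nth_mkseq.
Qed.

Definition minus1 : pfun baire baire := PFun minus1_fun.

Definition delta_wp X (d : representation X) : pfun baire X := pcomp d minus1.

(* The completion of X is option X, with None in the role of bottom. *)
Definition delta_bar_graph X (d : representation X) (p : baire)
    (z : option X) : Prop :=
  match z with
  | Some x => delta_wp d p x
  | None => ~ pdom (delta_wp d) p
  end.

Lemma delta_bar_fun X (d : representation X) p z z' :
  delta_bar_graph d p z -> delta_bar_graph d p z' -> z = z'.
Proof.
case: z z' => [x|] [x'|] // h h'.
- by rewrite (pgraph_fun h h').
- by case: h'; exists x.
- by case: h; exists x'.
Qed.

Definition delta_bar X (d : representation X) : pfun baire (option X) :=
  PFun (@delta_bar_fun X d).

Lemma delta_bar_surj X (d : representation X) z : exists p, delta_bar d p z.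
Proof.
case: z => [x|].
  have [q dqx] := rep_surj d x; exists (fun n => (q n).+1); exists q.
  split=> // k; exists k; rewrite /dec_concat /mkseq.
  by elim: (iota 0 k) => //= i s; rewrite eqxx.
exists (fun=> 0) => -[x [q [/(_ 1) [n]]]].
have -> : dec_concat (fun=> 0) n = [::].
  by rewrite /dec_concat; elim: (iota 0 n).
by [].
Qed.

Definition completion (X : repSpace) : repSpace :=
  RepSpace (Representation (@delta_bar_surj X (delta X))).

Definition completion_map (X Y : Type) (f : X -> Y -> Prop)
    (u : option X) (v : option Y) : Prop :=
  (exists x, [/\ u = Some x, mdom f x & exists2 y, v = Some y & f x y]) \/
  ~ (exists2 x, u = Some x & mdom f x).

Definition completed (f : problem) : problem :=
  @Problem (completion (pin f)) (completion (pout f)) (completion_map f).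

Definition complete (g : problem) : Prop := equivW g (completed g).
Definition strongly_complete (g : problem) : Prop := equivsW g (completed g).

(* Main.v *)
(** Both parts follow from the fact that f <=_tW g holds if and only if
    f <=_W g' for the completion g' of g (and likewise for the strong
    reductions), together with reflexivity and transitivity of <=_W. The key is
    that every computable F has a total computable G with G(p) - 1 = F(p) - 1
    on the domain of F: run F with increasing fuel and print the dummy symbol 0
    while waiting. Hence p |-> delta(p - 1) is a precomplete representation
    equivalent to delta, and its total realizers are realizers of g'. *)

From mathcomp Require Import all_boot.
From mathcomp Require Import boolp.
Require Import Defs.

Set Implicit Arguments.
Unset Strict Implicit.
Unset Printing Implicit Defensive.

(** * Total recursive functionals of fixed arity *)

(** Codes carry no arity, so [k] fixes the argument lists on which a code must be right. The closure
    lemmas below then produce codes for total functionals without any being written by hand. *)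
Definition prec (k : nat) (phi : baire -> seq nat -> nat) : Prop :=
  exists c, forall p v, size v = k -> reval p c v (phi p v).

Lemma prec_ext k phi psi :
  prec k phi -> (forall p v, size v = k -> phi p v = psi p v) -> prec k psi.
Proof. by move=> [c hc] e; exists c => p v sv; rewrite -e //; apply: hc. Qed.

Lemma prec_nth k i : prec k (fun _ v => nth 0 v i).
Proof. by exists (RProj i). Qed.

(** [RComp] needs a tuple of statically known length, hence the fixed output size [m]; one code is
    required per entry. *)
Definition precs (k m : nat) (F : baire -> seq nat -> seq nat) : Prop :=
  (forall p v, size v = k -> size (F p v) = m) /\
  forall i, prec k (fun p v => nth 0 (F p v) i).

Lemma prec_comp k m phi F :
  prec m phi -> precs k m F -> prec k (fun p v => phi p (F p v)).
Proof.
move=> [c hc] [sF hF].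
have [gs hgs] := @choice _ _ (fun (i : 'I_m) g => forall p v, size v = k ->
  reval p g v (nth 0 (F p v) i)) (fun i => hF i).
exists (RComp c gs) => p v sv.
have sz : size (F p v) == m by rewrite sF.
exists (Tuple sz); split=> [i|]; last by apply: hc; apply: sF.
by rewrite (tnth_nth 0); apply: hgs.
Qed.

Lemma precs_id k : precs k k (fun _ v => v).
Proof. by split=> // i; apply: prec_nth. Qed.

Lemma precs_drop j k m F :
  precs k (j + m) F -> precs k m (fun p v => drop j (F p v)).
Proof.
move=> [sF hF]; split=> [p v sv|i]; first by rewrite size_drop sF // addKn.
by apply: prec_ext (hF (j + i)) _ => p v _; rewrite nth_drop.
Qed.

Lemma prec_const k n : prec k (fun _ _ => n).
Proof.
elim: n => [|n [c hc]]; first by exists RZero.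
exists (@RComp 1 RSucc (fun=> c)) => p v sv.
by exists [tuple n]; split=> // i; rewrite ord1; apply: hc.
Qed.

Lemma precs_nil k : precs k 0 (fun _ _ => [::]).
Proof.
by split=> // i; apply: prec_ext (prec_const k 0) _ => p v _; rewrite nth_nil.
Qed.

Lemma precs_cons k m a F : prec k a -> precs k m F ->
  precs k m.+1 (fun p v => a p v :: F p v).
Proof.
by move=> ha [sF hF]; split=> [p v sv|[|i]] //=; rewrite sF.
Qed.

Lemma precs_map k m (psi : 'I_m -> baire -> seq nat -> nat) :
  (forall i, prec k (psi i)) ->
  precs k m (fun p v => [seq psi i p v | i <- enum 'I_m]).
Proof.
move=> h; split=> [p v _|i]; first by rewrite size_map size_enum_ord.
have [lt_im|le_mi] := ltnP i m.
  apply: prec_ext (h (Ordinal lt_im)) _ => p v _.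
  rewrite (nth_map (Ordinal lt_im)) ?size_enum_ord //.
  by rewrite -[X in nth _ _ X]/(val (Ordinal lt_im)) nth_ord_enum.
apply: prec_ext (prec_const k 0) _ => p v _.
by rewrite nth_default // size_map size_enum_ord.
Qed.

Lemma prec_succ k a : prec k a -> prec k (fun p v => (a p v).+1).
Proof.
move=> ha; have hS : prec 1 (fun _ v => (nth 0 v 0).+1) by exists RSucc.
exact: prec_comp hS (precs_cons ha (precs_nil k)).
Qed.

Lemma prec_oracle k a : prec k a -> prec k (fun p v => p (a p v)).
Proof.
move=> ha; have hO : prec 1 (fun p v => p (nth 0 v 0)) by exists ROracle.
exact: prec_comp hO (precs_cons ha (precs_nil k)).
Qed.

(** Convention for the step function: in [w] the recursion index comes first, the previous value
    second, and the original [k] arguments follow. [prec_case] likewise puts the predecessor in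
    front. *)
Lemma prec_rec k n a (g : baire -> seq nat -> nat -> nat -> nat) :
  prec k n -> prec k a ->
  prec k.+2 (fun p w => g p (drop 2 w) (nth 0 w 0) (nth 0 w 1)) ->
  prec k (fun p v => nat_rect (fun=> nat) (a p v) (g p v) (n p v)).
Proof.
move=> hn [ca ha] [cg hg].
pose phi (p : baire) (w : seq nat) :=
  nat_rect (fun=> nat) (a p (behead w)) (g p (behead w)) (head 0 w).
have hphi : prec k.+1 phi.
  exists (RPrim ca cg) => p [|x v] //= [sv].
  exists (fun i => nat_rect (fun=> nat) (a p v) (g p v) i); split=> //=.
    exact: ha.
  move=> i _; set r := nat_rect _ _ _ i.
  have -> : g p v i r = g p (drop 2 [:: i, r & v]) i r by rewrite /= drop0.
  by apply: (hg p [:: i, r & v]); rewrite /= sv.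
exact: prec_comp hphi (precs_cons hn (precs_id k)).
Qed.

Lemma prec_case k n a (b : baire -> seq nat -> nat -> nat) :
  prec k n -> prec k a ->
  prec k.+1 (fun p w => b p (drop 1 w) (nth 0 w 0)) ->
  prec k (fun p v => if n p v is m.+1 then b p v m else a p v).
Proof.
move=> hn ha hb.
apply: (@prec_ext _ (fun p v =>
    nat_rect (fun=> nat) (a p v) (fun i _ => b p v i) (n p v))).
  apply: (@prec_rec k n a (fun p v i _ => b p v i)) => //.
  apply: (@prec_ext _ (fun p w =>
    (fun p w => b p (drop 1 w) (nth 0 w 0)) p (nth 0 w 0 :: drop 2 w))).
    apply: prec_comp hb _; apply: precs_cons (prec_nth _ _) _.
    exact: (@precs_drop 2 k.+2 k _ (precs_id _)).
  by move=> p w _ /=; rewrite drop0.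
by move=> p v _; case: (n p v).
Qed.

Lemma prec_if k (b : baire -> seq nat -> bool) x y :
  prec k (fun p v => b p v : nat) -> prec k x -> prec k y ->
  prec k (fun p v => if b p v then x p v else y p v).
Proof.
move=> hb hx hy.
apply: (@prec_ext _ (fun p v =>
   if (b p v : nat) is m.+1 then (fun p v _ => x p v) p v m else y p v)).
  apply: prec_case => //.
  exact: prec_comp hx (@precs_drop 1 k.+1 k _ (precs_id _)).
by move=> p v _; case: (b p v).
Qed.

Lemma prec_pred k a : prec k a -> prec k (fun p v => (a p v).-1).
Proof.
move=> ha.
apply: (@prec_ext _ (fun p v =>
   if a p v is m.+1 then (fun _ _ i => i) p v m else 0)).
  by apply: prec_case => //; [apply: prec_const|apply: prec_nth].
by move=> p v _; case: (a p v).
Qed.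

Lemma prec_gt0 k a : prec k a -> prec k (fun p v => (0 < a p v) : nat).
Proof.
move=> ha.
apply: (@prec_ext _ (fun p v =>
   if a p v is m.+1 then (fun _ _ _ => 1) p v m else 0)).
  by apply: prec_case => //; apply: prec_const.
by move=> p v _; case: (a p v).
Qed.

Lemma prec_all k (I : Type) (r : seq I) (psi : I -> baire -> seq nat -> nat) :
  (forall i, prec k (psi i)) ->
  prec k (fun p v => all (fun i => 0 < psi i p v) r : nat).
Proof.
move=> h; elim: r => [|i r IHr] /=; first exact: prec_const.
apply: (@prec_ext _ (fun p v => if 0 < psi i p v then
    nat_of_bool (all (fun i => 0 < psi i p v) r) else 0)).
  by apply: prec_if => //; [apply: prec_gt0|apply: prec_const].
by move=> p v _; case: (0 < _).
Qed.

Lemma prec_add k a b : prec k a -> prec k b -> prec k (fun p v => a p v + b p v).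
Proof.
move=> ha hb.
apply: (@prec_ext _ (fun p v =>
   nat_rect (fun=> nat) (a p v) (fun _ r => r.+1) (b p v))).
  apply: (@prec_rec _ _ _ (fun _ _ _ r => r.+1)) => //.
  by apply: prec_succ; apply: prec_nth.
by move=> p v _; elim: (b p v) => [|n /= ->]; rewrite ?addn0 ?addnS.
Qed.

Lemma prec_sub k a b : prec k a -> prec k b -> prec k (fun p v => a p v - b p v).
Proof.
move=> ha hb.
apply: (@prec_ext _ (fun p v =>
   nat_rect (fun=> nat) (a p v) (fun _ r => r.-1) (b p v))).
  apply: (@prec_rec _ _ _ (fun _ _ _ r => r.-1)) => //.
  by apply: prec_pred; apply: prec_nth.
by move=> p v _; elim: (b p v) => [|n /= ->]; rewrite ?subn0 ?subnS.
Qed.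

Lemma prec_odd k a : prec k a -> prec k (fun p v => odd (a p v) : nat).
Proof.
move=> ha.
apply: (@prec_ext _ (fun p v =>
   nat_rect (fun=> nat) 0 (fun _ r => 1 - r) (a p v))).
  apply: (@prec_rec _ _ (fun _ _ => 0) (fun _ _ _ r => 1 - r)) => //.
    exact: prec_const.
  by apply: prec_sub; [apply: prec_const|apply: prec_nth].
by move=> p v _; elim: (a p v) => [|n /= ->] //; case: (odd n).
Qed.

Lemma prec_half k a : prec k a -> prec k (fun p v => (a p v)./2).
Proof.
move=> ha.
apply: (@prec_ext _ (fun p v =>
   nat_rect (fun=> nat) 0 (fun i r => odd i + r) (a p v))).
  apply: (@prec_rec _ _ (fun _ _ => 0) (fun _ _ i r => odd i + r)) => //.
    exact: prec_const.
  by apply: prec_add; [apply: prec_odd|]; apply: prec_nth.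
by move=> p v _; elim: (a p v) => [|n IHn] //; rewrite [LHS]/= IHn -uphalf_half.
Qed.

(** * Evaluation with fuel *)

(* A value 0 of h means undefined and y.+1 for y. The state is 0 while
   searching for a zero, 1 after an undefined value, and y.+2 once the zero y
   has been found. *)
Definition search (h : nat -> nat) (n : nat) : nat :=
  nat_rect (fun=> nat) 0
    (fun i st => if st is st'.+1 then st'.+1 else
       if h i is z.+1 then (if z is _.+1 then 0 else i.+2) else 1) n.

Lemma search_inv h n :
  match search h n with
  | 0 => forall i, i < n -> 1 < h i
  | 1 => True
  | y.+2 => [/\ y < n, h y = 1 & forall i, i < y -> 1 < h i]
  end.
Proof.
elim: n => [|n] //=; rewrite -/(search h n).
case: (search h n) => [lt1|[|y] //]; last by move=> [/ltnW].
case hn: (h n) => [|[|z]] // i; rewrite ltnS leq_eqVlt => /orP[/eqP->|/lt1//].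
by rewrite hn.
Qed.

Lemma search_found h n y :
  y < n -> h y = 1 -> (forall i, i < y -> 1 < h i) -> search h n = y.+2.
Proof.
move=> lt_yn hy lt1.
have search0 m : m <= y -> search h m = 0.
  elim: m => [|m IHm] //= lt_my; rewrite -/(search h m) IHm 1?ltnW //.
  by case: (h m) (lt1 m lt_my) => [|[]].
elim: n lt_yn => // n IHn; rewrite ltnS leq_eqVlt => /orP[/eqP<-|/IHn] /=.
  by rewrite -/(search h y) search0 // hy.
by rewrite -/(search h n) => ->.
Qed.

(* Evaluation with fuel s, with the same encoding of partial values. *)
Fixpoint ev (p : baire) (s : nat) (c : rcode) (v : seq nat) : nat :=
  match c with
  | RZero => 1
  | RSucc => (nth 0 v 0).+2
  | ROracle => (p (nth 0 v 0)).+1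
  | RProj i => (nth 0 v i).+1
  | RComp m f gs =>
      if all (fun i => 0 < ev p s (gs i) v) (enum 'I_m)
      then ev p s f [seq (ev p s (gs i) v).-1 | i <- enum 'I_m] else 0
  | RPrim f g =>
      nat_rect (fun=> nat) (ev p s f (behead v))
        (fun i r => if r is r'.+1 then ev p s g [:: i, r' & behead v] else 0)
        (head 0 v)
  | RMu f =>
      (search (fun i => ev p s f (i :: v)) s).-1
  end.

(** Fuel-bounded simulation of a fixed code is itself total recursive, with the fuel as first
    argument. The induction keeps [k] general because subcodes run at other arities. *)
Lemma prec_ev c k : prec k.+1 (fun p w => ev p (nth 0 w 0) c (drop 1 w)).
Proof.
elim: c k => [|||j|m f IHf gs IHg|f IHf g IHg|f IHf] k /=.
- exact: prec_const.
- apply: (@prec_ext _ (fun _ w => (nth 0 w 1).+2)).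
    by do 2!apply: prec_succ; apply: prec_nth.
  by move=> p v _; rewrite nth_drop.
- apply: (@prec_ext _ (fun p w => (p (nth 0 w 1)).+1)).
    by apply: prec_succ; apply: prec_oracle; apply: prec_nth.
  by move=> p v _; rewrite nth_drop.
- apply: (@prec_ext _ (fun p w => (nth 0 w j.+1).+1)).
    by apply: prec_succ; apply: prec_nth.
  by move=> p v _; rewrite nth_drop.
- apply: prec_if; last exact: prec_const.
    by apply: (@prec_all k.+1 _ _ (fun i p w => ev p (nth 0 w 0) (gs i) (drop 1 w))).
  apply: (@prec_ext _ (fun p w => (fun p w => ev p (nth 0 w 0) f (drop 1 w)) p
    (nth 0 w 0 :: [seq (ev p (nth 0 w 0) (gs i) (drop 1 w)).-1 | i <- enum 'I_m]))).
    apply: prec_comp (IHf m) _; apply: precs_cons (prec_nth _ _) _.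
    apply: (@precs_map k.+1 m (fun i p w => (ev p (nth 0 w 0) (gs i) (drop 1 w)).-1)).
    by move=> i; apply: prec_pred.
  by move=> p v _ /=; rewrite drop0.
(* Without arguments the recursion variable is read as 0, so only the base code [f] is run, on the
   empty list. *)
- case: k => [|k].
    apply: (@prec_ext _ (fun p w => ev p (nth 0 w 0) f (drop 1 w))) => //.
    by move=> p [|s [|]].
  apply: (@prec_rec k.+2 (fun p w => head 0 (drop 1 w))
    (fun p w => ev p (nth 0 w 0) f (behead (drop 1 w)))
    (fun p w i r => if r is r'.+1 then
       ev p (nth 0 w 0) g [:: i, r' & behead (drop 1 w)] else 0)).
  + by apply: (prec_ext (prec_nth _ 1)) => p v _; rewrite -nth0 nth_drop.
  + apply: (@prec_ext _ (fun p w =>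
      (fun p w => ev p (nth 0 w 0) f (drop 1 w)) p (nth 0 w 0 :: drop 2 w))).
      apply: prec_comp (IHf k) _; apply: precs_cons (prec_nth _ _) _.
      exact: (@precs_drop 2 _ k _ (precs_id _)).
    by move=> p v _ /=; rewrite drop0 -drop1 drop_drop.
  + apply: (@prec_case _ (fun _ w => nth 0 w 1) (fun _ _ => 0) (fun p w r' =>
      ev p (nth 0 (drop 2 w) 0) g [:: nth 0 w 0, r' & behead (drop 1 (drop 2 w))])).
    * exact: prec_nth.
    * exact: prec_const.
    (* Here [w] lists the decoded previous value, the index, the encoded previous value, the fuel,
       the recursion variable, and then the parameters from position 5 on. *)
    apply: (@prec_ext _ (fun p w => (fun p w => ev p (nth 0 w 0) g (drop 1 w)) p
      [:: nth 0 w 3, nth 0 w 1, nth 0 w 0 & drop 5 w])).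
      apply: prec_comp (IHg k.+2) _; do 3!apply: precs_cons (prec_nth _ _) _.
      exact: (@precs_drop 5 _ k _ (precs_id _)).
    by move=> p v _ /=; rewrite -drop1 !drop_drop !nth_drop.
- apply: prec_pred; rewrite /search.
  apply: (@prec_rec k.+1 (fun p w => nth 0 w 0) (fun _ _ => 0)
    (fun p w i st => if st is st'.+1 then st'.+1 else
      if ev p (nth 0 w 0) f (i :: drop 1 w) is z.+1 then
        (if z is _.+1 then 0 else i.+2) else 1)).
  + exact: prec_nth.
  + exact: prec_const.
  apply: (@prec_case _ (fun _ w => nth 0 w 1) _ (fun _ _ st' => st'.+1)).
  + exact: prec_nth.
  + apply: (@prec_case _
      (fun p w => ev p (nth 0 (drop 2 w) 0) f (nth 0 w 0 :: drop 1 (drop 2 w)))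
      (fun _ _ => 1)
      (fun _ w z => if z is _.+1 then 0 else (nth 0 w 0).+2)).
    * apply: (@prec_ext _ (fun p w => (fun p w => ev p (nth 0 w 0) f (drop 1 w)) p
        [:: nth 0 w 2, nth 0 w 0 & drop 3 w])).
        apply: prec_comp (IHf k.+1) _; do 2!apply: precs_cons (prec_nth _ _) _.
        exact: (@precs_drop 3 _ k _ (precs_id _)).
      by move=> p v _ /=; rewrite !drop_drop !nth_drop.
    * exact: prec_const.
    * apply: (@prec_case _ (fun _ w => nth 0 w 0) _ (fun _ _ _ => 0)).
      - exact: prec_nth.
      - apply: (@prec_ext _ (fun _ w => (nth 0 w 1).+2)).
          by do 2!apply: prec_succ; apply: prec_nth.
        by move=> p v _; rewrite nth_drop.
      exact: prec_const.
  + by apply: prec_succ; apply: prec_nth.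
Qed.

Lemma ev_mono p c v s s' :
  0 < ev p s c v -> s <= s' -> ev p s' c v = ev p s c v.
Proof.
elim: c v => [|||j|m f IHf gs IHg|f IHf g IHg|f IHf] v //=.
- case: ifP => // /allP gs_gt0 f_gt0 le_ss.
  have E i : ev p s' (gs i) v = ev p s (gs i) v.
    by apply: IHg => //; apply: gs_gt0; rewrite mem_enum.
  under eq_all do rewrite E.
  under eq_map do rewrite E.
  by rewrite (introT allP gs_gt0) IHf.
- move=> + le_ss; elim: (head 0 v) => [|n IHn] /=; first by move=> /IHf->.
  move: IHn; set r := nat_rect _ _ _ _; set r' := nat_rect _ _ _ _.
  by case: r => // r IHn /IHg H; rewrite IHn // H.
(* The predecessor sends states 0 and 1 to 0, so a positive value means that a zero [y] was found.
   By [search_inv] all values up to [y] are already defined, and more fuel leaves them unchanged. *)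
- case E: (search _ s) (search_inv (fun i => ev p s f (i :: v)) s) => [|[|y]] //=.
  move=> [lt_ys fy lt1] _ le_ss; rewrite (@search_found _ _ y) //.
  + exact: leq_trans le_ss.
  + by rewrite IHf // fy.
  + by move=> i /lt1 fi; rewrite IHf // ltnW.
Qed.

Lemma ev_sound p c v s y : ev p s c v = y.+1 -> reval p c v y.
Proof.
elim: c v y => [|||j|m f IHf gs IHg|f IHf g IHg|f IHf] v y /=.
- by case.
- by case.
- by case.
- by case.
- case: ifP => // /allP gs_gt0 /IHf hf.
  exists [tuple (ev p s (gs i) v).-1 | i < m]; split=> [i|].
    by rewrite tnth_mktuple; apply: IHg; rewrite prednK // gs_gt0 // mem_enum.
  by move: hf; congr (reval _ _ _ _); rewrite /= val_ord_tuple.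
- set r := nat_rect _ _ _ => hr.
  (* An undefined intermediate value makes all later ones undefined; since the last one is defined,
     descending induction makes every earlier one defined. *)
  have rgt0 i : i <= head 0 v -> 0 < r i.
    move=> le_i; rewrite -(subKn le_i); elim: (head 0 v - i) => [|d IHd].
      by rewrite subn0 hr.
    have [le_d|lt_d] := leqP (head 0 v) d.
      by move: IHd; move: (le_d); rewrite -subn_eq0 subnS => /eqP->.
    by move: IHd; rewrite subnS -[head 0 v - d]prednK ?subn_gt0 //=; case: (r _).
  exists (fun i => (r i).-1); split=> [|i lt_i|]; last by rewrite hr.
    by apply: IHf; rewrite prednK // rgt0.
  apply: IHg; move: (rgt0 i (ltnW lt_i)) (rgt0 i.+1 lt_i).
  by rewrite /=; case: (r i) => // r' _ /prednK->.
- case: (search _ s) (search_inv (fun i => ev p s f (i :: v)) s) => [|[|z]] //=.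
  move=> [_ fz lt1] [<-]; split=> [|i /lt1]; first exact: IHf.
  by case E: (ev _ _ _ _) => [|[|w]] // _; exists w; apply: IHf.
Qed.

Lemma ev_complete p c v y : reval p c v y -> exists s, ev p s c v = y.+1.
Proof.
elim: c v y => [|||j|m f IHf gs IHg|f IHf g IHg|f IHf] v y /=;
  try by move=> ->; exists 0.
- move=> [w [hw /IHf [s0 hs0]]].
  have [t ht] := choice (fun i => IHg i _ _ (hw i)).
  (* Finitely many subcomputations are involved, so by [ev_mono] the maximum of their fuels serves
     them all. *)
  pose s := maxn s0 (\max_i t i); exists s.
  have E i : ev p s (gs i) v = (tnth w i).+1.
    rewrite (ev_mono (s := t i)) ?ht // leq_max; apply/orP; right.
    exact: leq_bigmax.
  rewrite (introT allP) => [|i _]; last by rewrite E.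
  rewrite (_ : map _ _ = w).
    by rewrite (ev_mono (s := s0)) ?hs0 // leq_maxl.
  by rewrite -[RHS](map_tnth_enum w); apply: eq_map => i; rewrite E.
- move=> [r [/IHf [s0 hs0] hg ->]].
  elim: (head 0 v) hg => [|n IHn] hg; first by exists s0.
  have [|s1 hs1] := IHn; first by move=> i lt_i; apply: hg; apply: ltnW.
  have [s2 hs2] := IHg _ _ (hg n (leqnn _)).
  pose h s i := nat_rect (fun=> nat) (ev p s f (behead v))
    (fun i r => if r is r'.+1 then ev p s g [:: i, r' & behead v] else 0) i.
  have h_mono s s' i : 0 < h s i -> s <= s' -> h s' i = h s i.
    move=> + le_ss; elim: i => [|i IHi] /= h_gt0; first exact: ev_mono.
    rewrite -/(h s' i) -/(h s i) in h_gt0 *.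
    by case: (h s i) h_gt0 IHi => // x h_gt0 ->; rewrite ?(ev_mono h_gt0).
  exists (maxn s1 s2); rewrite /= -/(h (maxn s1 s2) n).
  rewrite (h_mono s1) ?leq_maxl /h ?hs1 //.
  by rewrite (ev_mono (s := s2)) ?hs2 // leq_maxr.
- move=> [/IHf [s0 hs0] hlt].
  have [t ht] : {t & forall i, i < y -> 1 < ev p (t i) f (i :: v)}.
    apply: (@choice _ _ (fun i t => i < y -> 1 < ev p t f (i :: v))) => i.
    have [lt_iy|le_yi] := ltnP i y; last by exists 0.
    by have [z /IHf [s hs]] := hlt i lt_iy; exists s; rewrite hs.
  (* The term [y.+1] is there because the search inspects only arguments below its fuel. *)
  pose s := maxn (maxn s0 y.+1) (\max_(i < y) t i); exists s.
  rewrite (@search_found _ _ y) //.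
  + by rewrite /s !leq_max leqnn orbT.
  + by rewrite (ev_mono (s := s0)) ?hs0 // /s !leq_max leqnn.
  + move=> i lt_iy; rewrite (ev_mono (s := t i)) ?ht ?(ltnW (ht _ _)) //.
    rewrite /s leq_max; apply/orP; right.
    exact: (leq_bigmax (F := fun i : 'I_y => t i) (Ordinal lt_iy)).
Qed.

(** Both results appear at a common fuel, where [ev] is a function. *)
Lemma reval_fun p c v y y' : reval p c v y -> reval p c v y' -> y = y'.
Proof.
move=> /ev_complete [s hs] /ev_complete [s' hs'].
have := @ev_mono p c v s (maxn s s'); have := @ev_mono p c v s' (maxn s s').
by rewrite hs hs' leq_maxl leq_maxr => -> // /(_ isT isT) [].
Qed.

(** * Computable functions on Baire space *)

(** For composition: the intermediate point is known only through the code [d], so each oracle query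
    is replaced by a run of [d] on the queried position. *)
Fixpoint osub (d c : rcode) : rcode :=
  match c with
  | ROracle => @RComp 1 d (fun=> RProj 0)
  | RComp m f gs => RComp (osub d f) (fun i : 'I_m => osub d (gs i))
  | RPrim f g => RPrim (osub d f) (osub d g)
  | RMu f => RMu (osub d f)
  | RZero => RZero
  | RSucc => RSucc
  | RProj i => RProj i
  end.

Lemma reval_osub p q d c v y : (forall n, reval p d [:: n] (q n)) ->
  reval q c v y -> reval p (osub d c) v y.
Proof.
move=> hd; elim: c v y => [|||j|m f IHf gs IHg|f IHf g IHg|f IHf] v y //=.
- move=> ->; exists [tuple nth 0 v 0]; split=> [i|]; last exact: hd.
  by rewrite ord1.
- by move=> [w [hw /IHf hf]]; exists w; split=> // i; apply: IHg.
- move=> [s [/IHf hf hg ->]]; exists s; split=> // i lt_i.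
  by apply: IHg; apply: hg.
- move=> [/IHf hf lt]; split=> // i /lt [z /IHf hz]; by exists z.
Qed.

Lemma computable_pcomp (G F : pfun baire baire) :
  computable G -> computable F -> computable (pcomp G F).
Proof.
move=> [c hc] [d hd]; exists (osub d c) => p r [q [Fpq Gqr]] n.
by apply: reval_osub (hd _ _ Fpq) (hc _ _ Gqr n).
Qed.

Lemma pfun_of_fun A B (T : A -> B) a b b' : b = T a -> b' = T a -> b = b'.
Proof. by move=> -> ->. Qed.

Definition pf A B (T : A -> B) : pfun A B := PFun (@pfun_of_fun A B T).

Lemma pf_total A B (T : A -> B) : ptotal (pf T).
Proof. by move=> a; exists (T a). Qed.

Lemma computable_pf (T : baire -> baire) :
  prec 1 (fun p v => T p (nth 0 v 0)) -> computable (pf T).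
Proof. by move=> [c hc]; exists c => p q -> n; apply: (hc p [:: n]). Qed.

Definition bfst (r : baire) : baire := fun n => r n.*2.
Definition bsnd (r : baire) : baire := fun n => r n.*2.+1.
Definition bsucc (p : baire) : baire := fun n => (p n).+1.

Lemma bpairK1 p q : bfst (bpair p q) = p.
Proof. by apply: funext => n; rewrite /bfst /bpair odd_double doubleK. Qed.

Lemma bpairK2 p q : bsnd (bpair p q) = q.
Proof.
by apply: funext => n; rewrite /bsnd /bpair /= odd_double /= uphalf_double.
Qed.

Lemma computable_bfst : computable (pf bfst).
Proof.
apply: computable_pf; rewrite /bfst; apply: prec_oracle.
apply: (@prec_ext _ (fun _ v => nth 0 v 0 + nth 0 v 0)) => [|p v _].
  by apply: prec_add; apply: prec_nth.
by rewrite addnn.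
Qed.

Lemma computable_bsnd : computable (pf bsnd).
Proof.
apply: computable_pf; rewrite /bsnd; apply: prec_oracle; apply: prec_succ.
apply: (@prec_ext _ (fun _ v => nth 0 v 0 + nth 0 v 0)) => [|p v _].
  by apply: prec_add; apply: prec_nth.
by rewrite addnn.
Qed.

Lemma computable_bsucc : computable (pf bsucc).
Proof.
by apply: computable_pf; apply: prec_succ; apply: prec_oracle; apply: prec_nth.
Qed.

Lemma computable_id : computable (pf (@id baire)).
Proof. by apply: computable_pf; apply: prec_oracle; apply: prec_nth. Qed.

Lemma ppair_fun (U V : pfun baire baire) r s s' :
  (exists a b, [/\ U r a, V r b & s = bpair a b]) ->
  (exists a b, [/\ U r a, V r b & s' = bpair a b]) -> s = s'.
Proof.
move=> [a [b [Ua Vb ->]]] [a' [b' [Ua' Vb' ->]]].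
by rewrite (pgraph_fun Ua Ua') (pgraph_fun Vb Vb').
Qed.

Definition ppair (U V : pfun baire baire) : pfun baire baire :=
  PFun (@ppair_fun U V).

Lemma computable_ppair U V :
  computable U -> computable V -> computable (ppair U V).
Proof.
move=> [cU hU] [cV hV].
have [sel hsel] : prec 3 (fun _ v =>
    if odd (nth 0 v 0) then nth 0 v 2 else nth 0 v 1).
  by apply: prec_if; [apply: prec_odd| |]; apply: prec_nth.
have [hf hhf] : prec 1 (fun _ v => (nth 0 v 0)./2).
  by apply: prec_half; apply: prec_nth.
pose half c := @RComp 1 c (fun=> hf).
(* Both components are evaluated at [n./2] before [sel] chooses by parity; this is harmless because
   [ppair] is defined only where both are. *)
exists (@RComp 3 sel (fun i => nth RZero [:: RProj 0; half cU; half cV] i)).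
move=> r _ [a [b [Ua Vb ->]]] n.
exists [tuple n; a n./2; b n./2]; split; last exact: (hsel r [:: n; _; _]).
have halfP c z : reval r c [:: n./2] z -> reval r (half c) [:: n] z.
  by move=> h; exists [tuple n./2]; split=> // i; rewrite ord1; apply: (hhf r [:: n]).
by case=> [[|[|[|i]]] lt_i] //; rewrite (tnth_nth 0) //=; apply: halfP; auto.
Qed.

Lemma dec_concatS p n : dec_concat p n.+1 = dec_concat p n ++ dec_word (p n).
Proof. by rewrite /dec_concat -addn1 iotaD map_cat flatten_cat /= cats0. Qed.

Lemma dec_concat_bsucc q n : dec_concat (bsucc q) n = mkseq q n.
Proof.
elim: n => // n IHn.
by rewrite dec_concatS IHn /mkseq -[in RHS]addn1 iotaD map_cat.
Qed.

Lemma minus1_bsucc q : minus1 (bsucc q) q.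
Proof. by move=> k; exists k; rewrite dec_concat_bsucc prefix_refl. Qed.

(* The n-th letter of p - 1 is found at the least t such that the first t + 1
   entries of p contribute more than n letters. *)
Lemma computable_minus1 : computable minus1.
Proof.
(* The truncated difference vanishes exactly when the first [t.+1] entries contribute more than [n]
   letters, which is the form of test that [RMu] accepts. *)
have [c hc] : prec 2 (fun p v =>
    (nth 0 v 1).+1 - size (dec_concat p (nth 0 v 0).+1)).
  apply: prec_sub; first by apply: prec_succ; apply: prec_nth.
  apply: (@prec_ext _ (fun p v => nat_rect (fun=> nat) 0
      (fun i r => r + (0 < p i)) (nth 0 v 0).+1)).
    apply: (@prec_rec _ _ (fun _ _ => 0) (fun p _ i r => r + (0 < p i))).
    - by apply: prec_succ; apply: prec_nth.
    - exact: prec_const.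
    apply: prec_add; first exact: prec_nth.
    by apply: prec_gt0; apply: prec_oracle; apply: prec_nth.
  move=> p v _; elim: (nth 0 v 0).+1 => [|n IHn] //.
  by rewrite dec_concatS size_cat -IHn /=; case: (p n).
have [d hd] : prec 1 (fun p v => (p (nth 0 v 0)).-1).
  by apply: prec_pred; apply: prec_oracle; apply: prec_nth.
exists (@RComp 1 d (fun=> RMu c)) => p q hq n.
have hlt : exists t, n < size (dec_concat p t.+1).
  have [t ht] := hq n.+1; exists t.
  have := size_prefix (prefix_trans ht (dec_concat_prefix p (leqnSn t))).
  by rewrite size_mkseq.
case: (ex_minnP hlt) => t lt_t min_t.
(* Each entry contributes at most one letter, so by minimality of [t] exactly [n] letters precede
   position [t], and entry [t] supplies letter [n]. *)
have size_t : size (dec_concat p t) = n.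
  apply/eqP; rewrite eqn_leq; apply/andP; split.
    case: t min_t {lt_t} => [|t] // min_t; rewrite leqNgt.
    by apply/negP => /min_t; rewrite ltnn.
  by move: lt_t; rewrite dec_concatS size_cat; case: (p t) => [|x] /=;
     rewrite ?addn0 ?addn1 ?ltnS // => /ltnW.
have -> : q n = (p t).-1.
  have [t' ht'] := hq n.+1.
  have h1 := prefix_trans ht' (dec_concat_prefix p (leq_maxl t' t.+1)).
  have h2 := dec_concat_prefix p (leq_maxr t' t.+1).
  have {h1} <- : nth 0 (dec_concat p (maxn t' t.+1)) n = q n.
    move: h1 => /prefixP [u ->].
    by rewrite nth_cat size_mkseq ltnSn nth_mkseq.
  move: h2 => /prefixP [u ->]; rewrite nth_cat lt_t dec_concatS nth_cat size_t.
  rewrite ltnn subnn; move: lt_t; rewrite dec_concatS size_cat size_t.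
  by case: (p t) => //=; rewrite addn0 ltnn.
exists [tuple t]; split=> [j|]; last exact: (hd p [:: t]).
rewrite ord1 /=; split=> [|i lt_it].
  have := hc p [:: t; n] erefl; rewrite /=.
  by move: lt_t; rewrite -subn_eq0 => /eqP->.
have := hc p [:: i; n] erefl; rewrite /=.
case E: (_ - _) => [|z]; last by exists z.
by move/eqP: E; rewrite subn_eq0 => /min_t; rewrite leqNgt lt_it.
Qed.

(* G simulates a machine for F and emits 0, which p - 1 erases, whenever the
   next output of F is not yet available. *)
Lemma computable_stretch F : computable F -> exists G : baire -> baire,
  computable (pf G) /\
  forall p q, F p q -> forall r, minus1 q r <-> minus1 (G p) r.
Proof.
move=> [c hc].
(* [pos p t] counts the outputs emitted before stage [t]; stage [t] tries output number [pos p t]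
   with fuel [t]. *)
pose pos (p : baire) t := nat_rect (fun=> nat) 0 (fun t k => k + (0 < ev p t c [:: k])) t.
have prec_ev1 k a b : prec k a -> prec k b ->
    prec k (fun p v => ev p (a p v) c [:: b p v]).
  move=> ha hb.
  exact: prec_comp (prec_ev c 1) (precs_cons ha (precs_cons hb (precs_nil k))).
have prec_pos : prec 1 (fun p v => pos p (nth 0 v 0)).
  apply: (@prec_rec _ _ (fun _ _ => 0) (fun p _ t k => k + (0 < ev p t c [:: k]))).
  - exact: prec_nth.
  - exact: prec_const.
  apply: prec_add; first exact: prec_nth.
  by apply: prec_gt0; apply: prec_ev1; apply: prec_nth.
(* The predecessor turns an undefined value into the dummy 0 and a defined one into the output
   itself. A genuine output 0 is erased in [q] as well. *)
exists (fun p t => (ev p t c [:: pos p t]).-1); split.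
  by apply: computable_pf; apply: prec_pred; apply: prec_ev1 => //; apply: prec_nth.
move=> p q Fpq; set G := fun t => _.
have dcG t : dec_concat G t = dec_concat q (pos p t).
  elim: t => // t IHt; rewrite dec_concatS IHt /= -/(pos p t) /G.
  case E: (ev p t c _) => [|y] /=; first by rewrite addn0 cats0.
  rewrite addn1 dec_concatS; congr (_ ++ dec_word _).
  exact: reval_fun (ev_sound E) (hc _ _ Fpq _).
have pos_le t d : pos p t <= pos p (t + d).
  elim: d => [|d IHd]; first by rewrite addn0.
  by rewrite addnS /= -/(pos p (t + d)) (leq_trans IHd) // leq_addr.
have unb k : exists t, k <= pos p t.
  elim: k => [|k [t le_kt]]; first by exists 0.
  have [s hs] := ev_complete (hc _ _ Fpq k).
  (* Either output [k] has been emitted before stage [t + s], or it is the one tried there, and the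
     fuel [t + s] is enough for it. *)
  have := leq_trans le_kt (pos_le t s).
  rewrite leq_eqVlt => /orP[/eqP Ek|lt_k]; last by exists (t + s).
  exists (t + s).+1; rewrite /= -/(pos p (t + s)) -Ek.
  by rewrite (ev_mono (s := s)) ?hs ?leq_addl // addn1.
move=> r; split=> hr k; have [n hn] := hr k.
  have [t le_nt] := unb n; exists t; rewrite dcG.
  exact: prefix_trans hn (dec_concat_prefix q le_nt).
by exists (pos p n); rewrite -dcG.
Qed.

(** * Precompletions and completions *)

Lemma delta_wp_surj X (d : representation X) x : exists p, delta_wp d p x.
Proof.
have [q dqx] := rep_surj d x; exists (bsucc q), q.
by split=> //; apply: minus1_bsucc.
Qed.

Definition wp_rep X (d : representation X) : representation X :=
  Representation (delta_wp_surj d).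

(** For precompleteness, stretching gives a total [G] that agrees with [F] up to inserted zeros,
    which [delta_wp] does not see. *)
Lemma wp_rep_precompletion X (d : representation X) : precompletion d (wp_rep d).
Proof.
split; [split|].
- exists (pf bsucc); first exact: computable_bsucc.
  move=> p x dpx; exists (bsucc p); split=> //; exists p.
  by split=> //; apply: minus1_bsucc.
- by exists minus1 => //; apply: computable_minus1.
move=> F /computable_stretch [G [cG hG]]; exists (pf G).
split=> [||p [q Fpq] x] //; first exact: pf_total.
split=> [[q' [Fpq' [r [hr drx]]]]|[_ [-> [r [hr drx]]]]].
  by exists (G p); split=> //; exists r; split=> //; apply/(hG _ _ Fpq').
by exists q; split=> //; exists r; split=> //; apply/(hG _ _ Fpq).
Qed.

Lemma delta_bar_ext X (d : representation X) p q z :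
  (forall r, minus1 p r <-> minus1 q r) -> delta_bar d p z -> delta_bar d q z.
Proof.
move=> e; have E x : delta_wp d p x <-> delta_wp d q x.
  by split=> -[r [/e hr drx]]; exists r.
case: z => [x|] /=; first by move/E.
by move=> nd [x /E hx]; apply: nd; exists x.
Qed.

Lemma delta_bar_total X (d : representation X) p : exists z, delta_bar d p z.
Proof.
have [[x hx]|nd] := pselect (pdom (delta_wp d) p); first by exists (Some x).
by exists None.
Qed.

Lemma completion_map_total X Y (f : X -> Y -> Prop) u : mdom (completion_map f) u.
Proof.
have [[x -> [y fxy]]|nd] := pselect (exists2 x, u = Some x & mdom f x).
  by exists (Some y); left; exists x; split=> //; exists y.
by exists None; right.
Qed.

(** Every [p] names some point of the completed space, possibly bottom, and the completed map has a
    value at every point. *)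
Lemma completed_realizer_total g G : realizes (completed g) G -> ptotal G.
Proof.
move=> hG p; have [z hz] := delta_bar_total (delta (pin g)) p.
by have [q [_ [Gpq _ _]]] := hG p z hz (completion_map_total _ _); exists q.
Qed.

(** Outside the domain of [g] any point of the completed output space is a correct answer, and every
    sequence names one; so it suffices that [G] returns something. *)
Lemma total_wp_realizer_completed (g : problem) G :
  total_realizer (wp_rep (delta (pin g))) (wp_rep (delta (pout g))) g G ->
  realizes (completed g) G.
Proof.
move=> [totG hG] p z hz _.
have [[x Ez dx]|nd] := pselect (exists2 x, z = Some x & mdom g x).
  rewrite Ez in hz; have [q [y [Gpq hq gxy]]] := hG p x hz dx.
  by exists q, (Some y); split=> //; left; exists x; split=> //; exists y.
have [q Gpq] := totG p; have [y hy] := delta_bar_total (delta (pout g)) q.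
by exists q, y; split=> //; right.
Qed.

(** * Reducibilities *)

(* Both forms of reducibility at once: c is <p, q> for the ordinary one, and q
   for the strong one. *)
Lemma via_fun (c : baire -> baire -> baire) (H G K : pfun baire baire) p r r' :
  (exists k q, [/\ K p k, G k q & H (c p q) r]) ->
  (exists k q, [/\ K p k, G k q & H (c p q) r']) -> r = r'.
Proof.
move=> [k [q [Kk Gq Hr]]] [k' [q' [Kk' Gq' Hr']]].
rewrite (pgraph_fun Kk Kk') in Gq; rewrite (pgraph_fun Gq Gq') in Hr.
exact: pgraph_fun Hr Hr'.
Qed.

Definition via c H G K : pfun baire baire := PFun (@via_fun c H G K).

(** The three closure properties serve, in order, reflexivity, change of names on both sides of a
    reduction, and transitivity. *)
Record combiner (c : baire -> baire -> baire) : Prop := Combiner {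
  combiner_snd : exists2 D, computable D & forall p q, D (c p q) q;
  combiner_map : forall A B, computable A -> computable B ->
    exists2 D, computable D &
      forall p q a b, A p a -> B q b -> D (c p q) (c a b);
  combiner_feed : forall H K, computable H -> computable K ->
    exists2 D, computable D &
      forall p q k r, K p k -> H (c k q) r -> D (c p q) (c p r) }.

Lemma combiner_strong : combiner (fun _ q => q).
Proof.
split=> [|A B _ cB|H K cH _].
- by exists (pf id) => //; apply: computable_id.
- by exists B.
- by exists H.
Qed.

Lemma combiner_bpair : combiner bpair.
Proof.
have cfst := computable_bfst; have csnd := computable_bsnd.
split=> [|A B cA cB|H K cH cK].
- by exists (pf bsnd) => // p q /=; rewrite bpairK2.
- exists (ppair (pcomp A (pf bfst)) (pcomp B (pf bsnd))).
    by apply: computable_ppair; apply: computable_pcomp.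
  move=> p q a b Aa Bb; exists a, b; split=> //=.
    by exists p; rewrite bpairK1.
  by exists q; rewrite bpairK2.
- exists (ppair (pf bfst) (pcomp H (ppair (pcomp K (pf bfst)) (pf bsnd)))).
    apply: computable_ppair => //; apply: computable_pcomp => //.
    by apply: computable_ppair => //; apply: computable_pcomp.
  move=> p q k r Kk Hr; exists p, r; split=> //=; first by rewrite bpairK1.
  exists (bpair k q); split=> //; exists k, q; rewrite bpairK2; split=> //.
  by exists p; rewrite bpairK1.
Qed.

Definition red c (f g : problem) : Prop :=
  exists H K : pfun baire baire, [/\ computable H, computable K
    & forall G, realizes g G -> realizes f (via c H G K)].

Definition tred c (f g : problem) : Prop :=
  exists (dX : representation (pin f)) (dY : representation (pout f))
         (dZ : representation (pin g)) (dW : representation (pout g)),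
    [/\ precompletion (delta (pin f)) dX, precompletion (delta (pout f)) dY,
        precompletion (delta (pin g)) dZ, precompletion (delta (pout g)) dW
      & exists H K : pfun baire baire,
          [/\ computable H, computable K
            & forall G, total_realizer dZ dW g G ->
                total_realizer dX dY f (via c H G K)]].

Lemma pfun_ext A B (F G : pfun A B) : (forall a b, F a b <-> G a b) -> F = G.
Proof.
case: F G => [F hF] [G hG] /= e.
have E : F = G by apply: funext => a; apply: funext => b; apply: propext.
by move: hF; rewrite E => hF; congr PFun; apply: Prop_irrelevance.
Qed.

Lemma via_bpair H G K : via bpair H G K = pcomp H (pairid (pcomp G K)).
Proof.
apply: pfun_ext => p r; split=> [[k [q [Kk Gq Hr]]]|].
  by exists (bpair p q); split=> //; exists q; split=> //; exists k.
by move=> [_ [[q [[k [Kk Gq]] ->]] Hr]]; exists k, q.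
Qed.

Lemma via_strong H G K : via (fun _ q => q) H G K = pcomp H (pcomp G K).
Proof.
apply: pfun_ext => p r; split=> [[k [q [Kk Gq Hr]]]|].
  by exists q; split=> //; exists k.
by move=> [q [[k [Kk Gq]] Hr]]; exists k, q.
Qed.

Lemma red_bpair f g : red bpair f g = leW f g.
Proof.
rewrite /red /leW; do 2!(congr ex; apply: funext => ?).
by under eq_forall do rewrite via_bpair.
Qed.

Lemma red_strong f g : red (fun _ q => q) f g = lesW f g.
Proof.
rewrite /red /lesW; do 2!(congr ex; apply: funext => ?).
by under eq_forall do rewrite via_strong.
Qed.

Lemma tred_bpair f g : tred bpair f g = letW f g.
Proof.
rewrite /tred /letW; do 4!(congr ex; apply: funext => ?); congr and5.
do 2!(congr ex; apply: funext => ?).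
by under eq_forall do rewrite via_bpair.
Qed.

Lemma tred_strong f g : tred (fun _ q => q) f g = lestW f g.
Proof.
rewrite /tred /lestW; do 4!(congr ex; apply: funext => ?); congr and5.
do 2!(congr ex; apply: funext => ?).
by under eq_forall do rewrite via_strong.
Qed.

Lemma red_refl c f : combiner c -> red c f f.
Proof.
move=> /combiner_snd [D cD hD]; exists D, (pf id).
split=> [||G hG p x hp dx] //; first exact: computable_id.
have [q [y [Gpq hq fxy]]] := hG p x hp dx.
by exists q, y; split=> //; exists p, q.
Qed.

(** For a realizer [G] of [h], the second reduction yields a realizer of [g], to which the first
    applies. [D] replaces the answer of [G] by that inner answer while keeping whatever [c] retains
    of the original input. *)
Lemma red_trans c f g h : combiner c -> red c f g -> red c g h -> red c f h.
Proof.
move=> hc [H1 [K1 [cH1 cK1 h1]]] [H2 [K2 [cH2 cK2 h2]]].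
have [D cD hD] := combiner_feed hc cH2 cK1.
exists (pcomp H1 D), (pcomp K2 K1).
split=> [||G /h2/h1 hG p x hp dx]; try exact: computable_pcomp.
have [r [y [[k [s [Kk [l [q [Kl Gq Hs]]] Hr]]] hr fxy]]] := hG p x hp dx.
exists r, y; split=> //; exists l, q; split=> //; first by exists k.
by exists (c p s); split=> //; apply: hD Kk Hs.
Qed.

Lemma upd_fun (G : pfun baire baire) k0 q0 k q q' :
  (k = k0 /\ q = q0) \/ (k <> k0 /\ G k q) ->
  (k = k0 /\ q' = q0) \/ (k <> k0 /\ G k q') -> q = q'.
Proof.
by move=> [[-> ->]|[nk Gq]] [[ek' ->]|[nk' Gq']] //; apply: pgraph_fun Gq Gq'.
Qed.

Definition upd G k0 q0 : pfun baire baire := PFun (@upd_fun G k0 q0).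

(** A realizer of the completion is total; enclosing it between total translations of names gives a
    total realizer of [g] for [dZ] and [dW], to which the hypothesis applies. *)
Lemma tred_completed c f g : combiner c -> tred c f g -> red c f (completed g).
Proof.
move=> hc [dX [dY [dZ [dW [[[eX _] _] [[_ eY] _] [[_ eZ] _] [[eW _] pW]
  [H [K [cH cK hHK]]]]]]]].
have [A cA hA] := eX; have [B cB hB] := eY.
have [C cC hC] := eZ; have [E cE hE] := eW.
(* [T1] totally translates [dZ] names into names for the completed input space; the shift by [bsucc]
   is undone by [minus1]. *)
have [T1 [cT1 hT1]] :=
  computable_stretch (computable_pcomp computable_bsucc cC).
(* The way back, from completed outputs to [dW] names, is made total by precompleteness of [dW]. *)
have [T2 [totT2 cT2 hT2]] := pW _ (computable_pcomp cE computable_minus1).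
have [D cD hD] := combiner_map hc cA cT2.
exists (pcomp B (pcomp H D)), (pcomp (pf T1) (pcomp K A)); split.
- by apply: computable_pcomp => //; apply: computable_pcomp.
- by apply: computable_pcomp => //; apply: computable_pcomp.
move=> G hG; have totG := completed_realizer_total hG.
have /hHK [_ hf] : total_realizer dZ dW g (pcomp T2 (pcomp G (pf T1))).
  split=> [p|p z hp [w0 gzw0]].
    have [q Gq] := totG (T1 p); have [r T2r] := totT2 q.
    by exists r, q; split=> //; exists (T1 p).
  have [p' [Cp hp']] := hC p z hp.
  have hT1p : delta_bar (delta (pin g)) (T1 p) (Some z).
    exists p'; split=> //; apply/(hT1 p (bsucc p')); first by exists p'.
    exact: minus1_bsucc.
  have [q [v [Gq hv gzv]]] := hG _ _ hT1p (completion_map_total _ _).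
  (* Since [z] lies in the domain of [g], the unrestricted branch of the completed map is impossible
     and the answer is a proper value. *)
  case: gzv => [[_ [[<-] _ [w Ev gzw]]]|[]]; last by exists z => //; exists w0.
  rewrite {}Ev in hv; have [q' [hq' dq'w]] := hv.
  have [e [Ee de]] := hE q' w dq'w.
  have [r [T2r dr]] : pcomp dW T2 q w.
    apply/hT2; first by exists e, q'.
    by exists e; split=> //; exists q'.
  by exists r, w; split=> //; exists q; split=> //; exists (T1 p).
move=> p x hp dx; have [a [Aa ha]] := hA p x hp.
have [r [y [[k [s [Kk [q [[t [-> Gq]] T2q]] Hr]]] hr fxy]]] := hf a x ha dx.
have [b [Bb hb]] := hB r y hr.
exists b, y; split=> //; exists (T1 k), q; split=> //.
  by exists k; split=> //; exists a.
by exists r; split=> //; exists (c a s); split=> //; apply: hD.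
Qed.

(* Stretching the given K only preserves the names it produces up to inserted
   zeros, so a realizer G at the stretched name k is compared with the realizer
   that answers G(k) at the original name. *)
Lemma completed_tred c f g : combiner c -> red c f (completed g) -> tred c f g.
Proof.
move=> hc [H [K [cH cK hHK]]].
exists (wp_rep (delta (pin f))), (wp_rep (delta (pout f))),
  (wp_rep (delta (pin g))), (wp_rep (delta (pout g))).
split; try exact: wp_rep_precompletion.
(* [D] restores the original name [p0] from the input [p], but leaves the answer [q] alone, since
   [H] already expects names in the completed output space. *)
have [D cD hD] := combiner_map hc computable_minus1 computable_id.
have [K' [cK' hK']] := computable_stretch (computable_pcomp cK computable_minus1).
have [H' [cH' hH']] := computable_stretch
  (computable_pcomp computable_bsucc (computable_pcomp cH cD)).
exists (pf H'), (pf K'); split=> // G hG.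
have [totG _] := hG; have {hG}hG := total_wp_realizer_completed hG.
split=> [p|p x [p0 [hp0 dp0]] dx].
  by have [q Gq] := totG (K' p); exists (H' (c p q)), (K' p), q.
have [q Gq] := totG (K' p).
(* [k0] and [K' p] name the same point of the completed space, so [q], being correct at [K' p], is
   correct at [k0] too. *)
pose G' k0 := upd G k0 q.
have hG' k0 : K p0 k0 -> realizes (completed g) (G' k0).
  move=> Kk0 k z hz dz; have [ek|nk] := pselect (k = k0).
    have hz' : delta_bar (delta (pin g)) (K' p) z.
      apply: delta_bar_ext hz => r; apply: hK'.
      by exists p0; rewrite ek.
    have [q' [y [Gq' hy gzy]]] := hG _ z hz' dz.
    exists q', y; split=> //; left; split=> //.
    exact: pgraph_fun Gq' Gq.
  have [q' [y [Gq' hy gzy]]] := hG _ z hz dz.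
  by exists q', y; split=> //; right.
(* Applying the reduction to [G] itself shows that [K] is defined at [p0]; only then can the
   modified realizer be formed. *)
have [k0 Kk0] : pdom K p0.
  by have [r [y [[k [s [Kk _ _]]] _ _]]] := hHK G hG p0 x dp0 dx; exists k.
have [r [y [[k [s [Kk Gs Hr]]] hr fxy]]] := hHK _ (hG' k0 Kk0) p0 x dp0 dx.
have {Gs} Es : s = q.
  by case: Gs => [[]|[nk _]] //; case: nk; apply: pgraph_fun Kk Kk0.
rewrite {}Es in Hr.
exists (H' (c p q)), y; split=> //; first by exists (K' p), q.
exists r; split=> //; apply/(hH' (c p q) (bsucc r)); last exact: minus1_bsucc.
by exists r; split=> //; exists (c p0 q); split=> //; apply: hD.
Qed.

Lemma completeP c g : combiner c ->
  (red c g (completed g) /\ red c (completed g) g) <->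
  (forall f, red c f g <-> tred c f g).
Proof.
move=> hc; have tredE f : tred c f g <-> red c f (completed g).
  by split; [apply: tred_completed|apply: completed_tred].
split=> [[le1 le2] f|h].
  by rewrite tredE; split=> hf; apply: red_trans hf _.
(* The instances are [f := g] for the first reduction and [f := completed g] for the second. *)
by split; [apply/tredE/h|apply/h/tredE]; apply: red_refl.
Qed.

Theorem theorem5p7 (g : problem) :
  (complete g <-> forall f : problem, leW f g <-> letW f g) /\
  (strongly_complete g <-> forall f : problem, lesW f g <-> lestW f g).
Proof.
have h1 := completeP g combiner_bpair; have h2 := completeP g combiner_strong.
split.
  rewrite /complete /equivW -!red_bpair h1.
  by split=> h f; have := h f; rewrite red_bpair tred_bpair.
rewrite /strongly_complete /equivsW -!red_strong h2.
by split=> h f; have := h f; rewrite red_strong tred_strong.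
Qed.
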